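(* Let $t$ be a positive integer, let $\mathcal{G} = \{G_1, \ldots, G_t\}$ be a family of $(n,D,\lambda)$-graphs on the same vertex set $V(\mathcal{G})$, and let $S \subseteq V(\mathcal{G})$. Then $\mathcal{G}[S]$ contains every $[t]$-colored path $\mathcal{P}$ with at most $|S| - 2 \lambda n D^{-1} t^{1/2}$ vertices.
   Context: Graphs are finite and simple. A graph $G$ is an $(n,D,\lambda)$-graph if it is a $D$-regular graph on $n$ vertices and all but at most one of the eigenvalues of its adjacency matrix (counted with multiplicity) are bounded in absolute value by $\lambda$; here $D>0$, so that $\lambda nD^{-1}$ is defined. All graphs of the family have the same parameters $n,D,\lambda$. $[t]=\{1,\ldots,t\}$. For $S\subseteq V(\mathcal{G})$, $\mathcal{G}[S]=\{G_1[S],\ldots,G_t[S]\}$, where $G_i[S]$ is the subgraph of $G_i$ induced by $S$. A $[t]$-colored path $\mathcal{P}$ is a path $P$ with an arbitrary map $f:E(P)\to[t]$. $\mathcal{G}[S]$ contains $\mathcal{P}$ if there is an injective map $\phi:V(P)\to S$ such that $\phi(u)\phi(v)\in E(G_{f(uv)})$ for every edge $uv\in E(P)$. *)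

(* Defs.v *)
From HB Require Import structures.
From mathcomp Require Import all_boot all_order all_algebra.

Set Implicit Arguments.
Unset Strict Implicit.
Unset Printing Implicit Defensive.

Import Order.TTheory GRing.Theory Num.Theory.
Local Open Scope ring_scope.

Record sgraph (V : finType) := SGraph {
  edge :> rel V;
  edge_sym : symmetric edge;
  edge_irr : irreflexive edge
}.

Definition adj_mx (R : rcfType) (V : finType) (G : sgraph V) : 'M[R]_#|V| :=
  \matrix_(i, j) (G (enum_val i) (enum_val j))%:R.

(* Every root of the characteristic polynomial of a symmetric matrix over a
   real closed field lies in that field, so a list [s] as below exists for every
   adjacency matrix and is unique up to order. *)
Definition is_spectrum (R : rcfType) (m : nat) (A : 'M[R]_m) (s : seq R) : Prop :=
  char_poly A = \prod_(a <- s) ('X - a%:P).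

Definition regular (V : finType) (G : sgraph V) (D : nat) : Prop :=
  forall v : V, #|[set w | G v w]| = D.

Definition ndl_graph (R : rcfType) (V : finType) (n D : nat) (lam : R)
    (G : sgraph V) : Prop :=
  [/\ #|V| = n,
      (0 < D)%N,
      regular G D
    & exists2 s : seq R, is_spectrum (adj_mx R G) s
                       & (count (fun a => ~~ (`|a| <= lam)%R) s <= 1)%N].

Definition is_path_graph (W : finType) (P : sgraph W) : Prop :=
  exists s : seq W,
    [/\ uniq s,
        forall w, w \in s
      & forall u v, P u v = (index v s == (index u s).+1)
                         || (index u s == (index v s).+1)].

(* The colouring [f] is total on subsets of [W], but only its values on edges
   [[set u; v]] of [P] are used; for [t > 0] every map from the edge set of [P]
   to ['I_t] arises by restriction. *)
Definition contains_in (V W : finType) (t : nat) (G : 'I_t -> sgraph V)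
    (S : {set V}) (P : sgraph W) (f : {set W} -> 'I_t) : Prop :=
  exists phi : W -> V,
    [/\ injective phi,
        forall w, phi w \in S
      & forall u v, P u v -> G (f [set u; v]) (phi u) (phi v)].

(* Main.v *)
Require Import Defs.
From mathcomp Require Import all_boot all_order all_algebra.
From mathcomp Require Import complex zify ring lra.

(** The path is embedded by a depth-first search in [S]. The search keeps a
    stack, which is an initial segment of the coloured path embedded in [S], a
    set [T] of vertices not yet reached and a set [B] of dead vertices. If the
    top [x] of the stack has a neighbour in [T] in the colour that the path
    prescribes next, that neighbour is pushed; otherwise [x] is popped and dies,
    and it is labelled with that colour. As [T] only shrinks, a dead vertex [x]
    with label [i] never has a [G_i]-neighbour in [T] again.

    Every step lowers [#|T| - #|B|] by exactly one, starting from [#|S|]. So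
    unless the whole path gets embedded, there is a moment when
    [#|T| = #|B| = k], and then the stack has [#|S| - 2k] vertices, fewer than
    the path ([cpath_or_nonadjacent]).

    On the other hand [k] is small. Split [B] into the classes [B_i] of its
    labels; there is no edge of [G_i] between [B_i] and [T]. For an
    (n,D,lam)-graph this forces [D^2 #|B_i| #|T| <= (lam n)^2]
    ([nonadjacent_card]), and summing over the [t] colours gives
    [D^2 k^2 <= t (lam n)^2], that is [2k <= 2 lam n D^-1 sqrt t]. Hence the path,
    by the assumption on its length, has at most [#|S| - 2k] vertices: a
    contradiction. Summing the products [#|B_i| #|T|], instead of looking for one
    large class, is what yields [sqrt t] in the bound.

    The bound on nonadjacent sets is the variance form of the expander mixing
    lemma: apply the adjacency matrix to the indicator vector of [T] minus its
    mean. On a vertex with no neighbour in [T] the value is [- D #|T| / n], and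
    the squared norm of the image is at most [lam^2 #|T|], because a vector
    orthogonal to the all-one vector only sees the eigenvalues bounded by [lam]
    ([spectral_gap]). *)

Import Order.TTheory GRing.Theory Num.Theory.
Set Implicit Arguments.
Unset Strict Implicit.
Unset Printing Implicit Defensive.
Local Open Scope ring_scope.

(** * Matrices with at most one large eigenvalue *)

Lemma char_poly_conj (F : fieldType) m (P A : 'M[F]_m) :
  P \in unitmx -> char_poly (invmx P *m A *m P) = char_poly A.
Proof.
move=> Pu; rewrite /char_poly /char_poly_mx !map_mxM.
have Pu' : map_mx polyC P \in unitmx by rewrite map_unitmx.
have XE : 'X%:M = map_mx polyC (invmx P) *m 'X%:M *m map_mx polyC P.
  by rewrite scalar_mxC -mulmxA -map_mxM mulVmx // map_mx1 mulmx1.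
rewrite {1}XE -mulmxBl -mulmxBr !det_mulmx mulrAC -det_mulmx -map_mxM mulVmx //.
by rewrite map_mx1 det1 mul1r.
Qed.

Section SpectralGap.
Local Open Scope sesquilinear_scope.
Variables (C : numClosedFieldType) (m : nat).
Implicit Types (u v z : 'rV[C]_m) (A P : 'M[C]_m).

Lemma sum_sqr_unitary P v : P \is unitarymx ->
  \sum_j `|(v *m P) 0 j| ^+ 2 = \sum_j `|v 0 j| ^+ 2.
Proof.
have sqnormE (w : 'rV_m) : \sum_j `|w 0 j| ^+ 2 = (w *m w ^t*) 0 0 :> C.
  by rewrite mxE; apply: eq_bigr => j _; rewrite !mxE normCK.
by move=> Pu; rewrite !sqnormE trmx_mul map_mxM mulmxA mulmxtVK.
Qed.

(** Since only one eigenvalue, counted with multiplicity, exceeds [lam] in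
    absolute value, and [a] does, the coordinates of [u] in an orthonormal
    eigenbasis vanish except at one index [j0]. A vector orthogonal to [u] has
    coordinate zero there, and every other coordinate is multiplied by an
    eigenvalue of absolute value at most [lam]. *)
Lemma spectral_gap A (s : seq C) (a lam : C) u z :
    A \is normalmx -> char_poly A = \prod_(b <- s) ('X - b%:P) ->
    (count (fun b : C => ~~ (`|b| <= lam)%R) s <= 1)%N ->
    ~~ (`|a| <= lam) -> u != 0 -> u *m A = a *: u -> z *m u ^t* = 0 ->
  \sum_j `|(z *m A) 0 j| ^+ 2 <= lam ^+ 2 * \sum_j `|z 0 j| ^+ 2.
Proof.
move=> /orthomx_spectralP A_eq chA s_le1 a_gt u_neq0 uA zu.
set P := spectralmx A in A_eq; set d := spectral_diag A in A_eq.
have Pun : P \is unitarymx by exact: spectral_unitarymx.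
have Pu : P \in unitmx by exact: unitarymx_unit.
have Qun : P ^t* \is unitarymx by rewrite trmxC_unitary.
pose coord v := v *m P ^t*.
have coordA v j : coord (v *m A) 0 j = coord v 0 j * d 0 j.
  rewrite /coord {1}A_eq !mulmxA mulmxtVK // invmx_unitary //.
  by rewrite mul_mx_diag mxE.
have d_perm : perm_eq s [seq d 0 j | j : 'I_m].
  apply: prod_XsubC_eq; rewrite -chA A_eq char_poly_conj //.
  rewrite char_poly_trig ?diag_mx_is_trig // big_map big_enum /=.
  by apply: eq_bigr => j _; rewrite mxE eqxx mulr1n.
have cu_neq0 : coord u != 0.
  by apply: contra_neq u_neq0 => /(congr1 (mulmx^~ P)); rewrite mulmxKtV // mul0mx.
have /rV0Pn [j0 u_j0] := cu_neq0.
have eig j : coord u 0 j != 0 -> d 0 j = a.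
  move=> uj; apply: (mulfI uj); rewrite -coordA uA /coord -scalemxAl mxE.
  by rewrite mulrC.
(* Otherwise both [j] and [j0] would index an eigenvalue larger than [lam]. *)
have other j : j != j0 -> `|d 0 j| <= lam.
  move=> jj0; apply: contraTT s_le1 => dj.
  rewrite (permP d_perm) -ltnNge count_map -size_filter.
  apply: (@uniq_leq_size _ [:: j; j0]); first by rewrite /= inE jj0.
  by apply/allP; rewrite /= !mem_filter /= dj -enumT !mem_enum eig ?a_gt.
have z_j0 : coord z 0 j0 = 0.
  have /matrixP/(_ 0 0) : coord z *m (coord u) ^t* = 0.
    by rewrite trmx_mul map_mxM trmxCK mulmxA mulmxKtV.
  have adjE j : (coord u) ^t* j 0 = (coord u 0 j)^* by rewrite 2!mxE.
  rewrite mxE [RHS]mxE (bigD1 j0) //= adjE big1 ?addr0 => [|j jj0].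
    by move=> /eqP; rewrite mulf_eq0 conjC_eq0 (negPf u_j0) orbF => /eqP.
  rewrite adjE; have [->|/eig dj] := eqVneq (coord u 0 j) 0.
    by rewrite conjC0 mulr0.
  by move: (other j jj0); rewrite dj (negPf a_gt).
rewrite -(sum_sqr_unitary (z *m A) Qun) -(sum_sqr_unitary z Qun) mulr_sumr.
apply: ler_sum => j _; rewrite -/(coord _) -/(coord z) coordA normrM exprMn.
have [->|jj0] := eqVneq j j0; first by rewrite z_j0 normr0 expr0n /= !mul0r mulr0.
rewrite mulrC ler_wpM2r ?exprn_ge0 // ler_pXn2r ?nnegrE ?other //.
exact: le_trans (other _ jj0).
Qed.
End SpectralGap.

Section RealSpectralGap.
Local Open Scope sesquilinear_scope.
Local Open Scope complex_scope.

(** The orthonormal eigenbasis comes from the spectral theorem over an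
    algebraically closed field, so the real case is read off in [R[i]], where a
    real symmetric matrix is normal. *)
Lemma real_spectral_gap (R : rcfType) m (A : 'M[R]_m) (s : seq R) (a lam : R)
    (u z : 'rV[R]_m) :
    A^T = A -> is_spectrum A s ->
    (count (fun b => ~~ (`|b| <= lam)%R) s <= 1)%N ->
    lam < `|a| -> u != 0 -> u *m A = a *: u -> z *m u^T = 0 ->
  \sum_j (z *m A) 0 j ^+ 2 <= lam ^+ 2 * \sum_j z 0 j ^+ 2.
Proof.
move=> A_sym chA s_le1 a_gt u_neq0 uA zu.
pose toC : {rmorphism R -> R[i]} := real_complex R.
pose toCm k n := @map_mx _ _ toC k n.
have normC x : `|toC x| = toC `|x|.
  by rewrite normc_def /= expr0n /= addr0 sqrtr_sqr.
have sumC (v : 'rV_m) : \sum_j `|toCm _ _ v 0 j| ^+ 2 = toC (\sum_j v 0 j ^+ 2).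
  rewrite rmorph_sum; apply: eq_bigr => j _.
  by rewrite mxE normC -rmorphXn real_normK ?num_real.
have conjCm k n (M : 'M_(k, n)) : (toCm k n M)^t* = toCm n k M^T.
  by apply/matrixP => i j; rewrite !mxE; exact: conjc_real.
rewrite -lecR rmorphM rmorphXn -!sumC /toCm map_mxM.
apply: (@spectral_gap _ _ _ [seq toC b | b <- s] (toC a) _ (toCm _ _ u)).
- by apply/normalmxP; rewrite conjCm A_sym.
- by rewrite -map_char_poly chA map_prod_XsubC big_map.
- rewrite count_map; apply: leq_trans s_le1; apply: sub_count => b /=.
  by rewrite normC lecR.
- by rewrite normC lecR -ltNge.
- by rewrite map_mx_eq0.
- by rewrite -map_mxM uA map_mxZ.
- by rewrite conjCm -map_mxM zu map_mx0.
Qed.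

End RealSpectralGap.

(** * Nonadjacent sets in (n,D,lam)-graphs *)

Section NonAdjacent.
Variables (R : rcfType) (V : finType).
Implicit Types (G : sgraph V) (A T : {set V}).

Lemma sum_enum_val (F : V -> R) :
  \sum_(i < #|V|) F (enum_val i) = \sum_v F v.
Proof. by rewrite [RHS](reindex _ (onW_bij _ (enum_val_bij V))). Qed.

Lemma sum_edge G D v : regular G D -> \sum_w (G w v)%:R = D%:R :> R.
Proof.
move=> G_reg; rewrite -(G_reg v) -sum1_card natr_sum [RHS]big_mkcond.
by apply: eq_bigr => w _; rewrite edge_sym inE; case: (G v w).
Qed.

Lemma sum_indicator T : \sum_v (v \in T)%:R = #|T|%:R :> R.
Proof.
by rewrite -sum1_card natr_sum [RHS]big_mkcond; apply: eq_bigr => v _; case: ifP.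
Qed.

(** With [z] the indicator vector of [T] minus its mean [tau = #|T| / n] and [M]
    the adjacency matrix, [z M] equals [- tau D] on all of [A], so
    [#|A| (tau D)^2 <= |z M|^2 <= lam^2 |z|^2 <= lam^2 #|T|]. The spectral gap
    applies only if the eigenvalue [D] is the exceptional one; if
    [D <= |lam|], the bound follows from [#|A|, #|T| <= n]. *)
Lemma nonadjacent_card n D (lam : R) G A T :
    ndl_graph n D lam G -> {in A & T, forall a b, ~~ G a b} ->
  D%:R ^+ 2 * #|A|%:R * #|T|%:R <= (lam * n%:R) ^+ 2.
Proof.
case=> Vn D_gt0 G_reg [s G_spec s_le1] AT0.
have le_n (X : {set V}) : #|X|%:R <= n%:R :> R by rewrite ler_nat -Vn max_card.
have sqn (x : R) : x ^+ 2 = `|x| ^+ 2 by rewrite real_normK ?num_real.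
have [D_le|lam_lt] := lerP D%:R `|lam|.
  rewrite exprMn -mulrA (sqn lam) expr2 [n%:R ^+ 2]expr2.
  by rewrite !ler_pM ?mulr_ge0 ?ler0n.
have [->|[v0 v0T]] := set_0Vmem T; first by rewrite cards0 mulr0 sqr_ge0.
have n_gt0 : 0 < n%:R :> R by rewrite ltr0n -Vn; apply/card_gt0P; exists v0.
have T_gt0 : 0 < #|T|%:R :> R by rewrite ltr0n; apply/card_gt0P; exists v0.
pose tau : R := #|T|%:R / n%:R.
pose zf v : R := (v \in T)%:R - tau.
pose z : 'rV[R]_#|V| := \row_j zf (enum_val j).
have zM j : (z *m adj_mx R G) 0 j = \sum_w zf w * (G w (enum_val j))%:R.
  rewrite mxE -sum_enum_val; apply: eq_bigr => i _.
  by rewrite !mxE.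
have zA v : v \in A -> \sum_w zf w * (G w v)%:R = - (tau * D%:R).
  move=> vA; rewrite -(sum_edge v G_reg) mulr_sumr -sumrN; apply: eq_bigr => w _.
  rewrite /zf; case: (boolP (w \in T)) => [wT|_]; last by rewrite sub0r mulNr.
  by rewrite edge_sym (negPf (AT0 _ _ vA wT)) !mulr0 oppr0.
have sum_tau : \sum_(v : V) tau = #|T|%:R.
  by rewrite sumr_const Vn -[tau *+ _]mulr_natr divfK ?gt_eqF.
have z1 : z *m (const_mx 1 : 'rV_#|V|)^T = 0.
  apply/matrixP => i j; rewrite !mxE.
  under eq_bigr do rewrite !mxE mulr1.
  by rewrite (sum_enum_val zf) sumrB sum_indicator sum_tau subrr.
have u1 : (const_mx 1 : 'rV[R]_#|V|) *m adj_mx R G = D%:R *: const_mx 1.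
  apply/rowP => j; rewrite !mxE mulr1 -(sum_edge (enum_val j) G_reg).
  rewrite -sum_enum_val; apply: eq_bigr => i _.
  by rewrite !mxE mul1r.
have u_neq0 : (const_mx 1 : 'rV[R]_#|V|) != 0.
  by apply/rV0Pn; exists (enum_rank v0); rewrite mxE oner_eq0.
have M_sym : (adj_mx R G)^T = adj_mx R G.
  by apply/matrixP => i j; rewrite !mxE edge_sym.
have lam_lt' : lam < `|D%:R|.
  by rewrite normr_nat; apply: le_lt_trans lam_lt; apply: ler_norm.
have := real_spectral_gap M_sym G_spec s_le1 lam_lt' u_neq0 u1 z1.
under eq_bigr do rewrite zM.
rewrite (sum_enum_val (fun v => (\sum_w zf w * (G w v)%:R) ^+ 2)) => gap.
have A_le : #|A|%:R * (tau * D%:R) ^+ 2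
    <= \sum_v (\sum_w zf w * (G w v)%:R) ^+ 2.
  rewrite (bigID (mem A)) /= -[leLHS]addr0 lerD //; last first.
    by apply: sumr_ge0 => v _; apply: sqr_ge0.
  rewrite -sum1_card natr_sum mulr_suml le_eqVlt; apply/orP; left; apply/eqP.
  by apply: eq_bigr => v /zA ->; rewrite mul1r sqrrN.
have T_le : \sum_j z 0 j ^+ 2 <= #|T|%:R.
  under eq_bigr do rewrite mxE.
  rewrite (sum_enum_val (fun v => zf v ^+ 2)).
  have -> : \sum_v zf v ^+ 2 = (1 - tau) * #|T|%:R.
    transitivity (\sum_v ((1 - 2 * tau) * (v \in T)%:R + tau * tau)).
      by apply: eq_bigr => v _; rewrite /zf; case: (v \in T) => /=; ring.
    by rewrite big_split /= -mulr_sumr sum_indicator -mulr_sumr sum_tau; ring.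
  by rewrite ler_piMl ?ler0n // lerBlDr lerDl divr_ge0 ?ler0n.
have /(le_trans A_le) : \sum_v (\sum_w zf w * (G w v)%:R) ^+ 2 <= lam ^+ 2 * #|T|%:R.
  by apply: le_trans gap _; rewrite ler_wpM2l ?sqr_ge0.
rewrite /tau => main.
have n2 : 0 < n%:R ^+ 2 :> R by rewrite exprn_gt0.
rewrite -(ler_pM2r T_gt0).
have -> : D%:R ^+ 2 * #|A|%:R * #|T|%:R * #|T|%:R
    = #|A|%:R * (#|T|%:R / n%:R * D%:R) ^+ 2 * n%:R ^+ 2 :> R.
  by field; rewrite gt_eqF.
have -> : (lam * n%:R) ^+ 2 * #|T|%:R = lam ^+ 2 * #|T|%:R * n%:R ^+ 2 by ring.
by rewrite ler_pM2r.
Qed.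

(** If [lam < 0], every eigenvalue violates the bound, so there is at most one
    vertex; but a vertex of positive degree has a neighbour. *)
Lemma ndl_lam_ge0 n D (lam : R) G :
  ndl_graph n D lam G -> (0 < #|V|)%N -> 0 <= lam.
Proof.
case=> _ D_gt0 G_reg [s G_spec s_le1] /card_gt0P [v0 _].
rewrite leNgt; apply: contraTN s_le1 => lam_lt0.
have size_s : size s = #|V|.
  by apply: succn_inj; rewrite -(size_char_poly (adj_mx R G)) G_spec size_prod_XsubC.
rewrite (@eq_in_count _ _ predT) ?count_predT ?size_s => [|a _]; last first.
  by rewrite /= -ltNge (lt_le_trans lam_lt0).
move: D_gt0; rewrite -(G_reg v0) card_gt0 -ltnNge => /set0Pn [w].
rewrite inE => v0w; apply/card_gt1P; exists v0, w; split=> //.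
by apply: contraTneq v0w => <-; rewrite edge_irr.
Qed.
End NonAdjacent.

(** * Depth-first search for a coloured path *)

Section ColouredDFS.
Variables (V I : finType) (e : I -> rel V) (c : nat -> I).
Implicit Types (st T B : seq V) (x y : V).

(** A stack is listed from its top, so the path it carries is its reversal. The
    edge from vertex [k - 1] of the path to vertex [k] (counted from 0) has
    colour [c k]; thus [c (size s)] is the colour of the edge by which a vertex
    is pushed onto [s]. *)
Fixpoint cpath st : bool :=
  if st is x :: s then
    (if s is y :: _ then e (c (size s)) y x else true) && cpath s
  else true.

Lemma cpath_nth x0 st k : cpath st -> (k.+1 < size st)%N ->
  e (c k.+1) (nth x0 (rev st) k) (nth x0 (rev st) k.+1).
Proof.
elim: st => // x s IHs /= /andP[ex cs]; rewrite ltnS leq_eqVlt => /predU1P[k_eq|lt_k].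
  rewrite rev_cons !nth_rcons size_rev -k_eq ltnSn ltnn eqxx k_eq.
  case: s ex k_eq {IHs cs} => // y s ex [->].
  by rewrite rev_cons nth_rcons size_rev ltnn eqxx.
by rewrite rev_cons !nth_rcons size_rev lt_k ltnW //; apply: IHs.
Qed.

Variables (S : {set V}) (m : nat).

(** The situation after [r] steps, each of which has lowered [size T - size B] by
    one; [dfs_size] records this without truncated subtraction. The label [g x]
    is the colour in which the path could not be extended from [x]. *)
Record dfs_state (r : nat) T B st (g : V -> I) : Prop := DfsState {
  dfs_perm : perm_eq (T ++ B ++ st) (enum S);
  dfs_path : cpath st;
  dfs_size : (size T + r = #|S| + size B)%N;
  dfs_dead : forall x y, x \in B -> y \in T -> ~~ e (g x) x y
}.

Lemma dfs_push r T B st g x :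
    dfs_state r T B st g -> x \in T -> cpath (x :: st) ->
  dfs_state r.+1 (rem x T) B (x :: st) g.
Proof.
case=> Sperm _ Tsize dead xT cst; split=> //.
- apply/permP => p; rewrite -(permP Sperm) !count_cat /=.
  by rewrite (permP (perm_to_rem xT)) /=; lia.
- have := perm_size (perm_to_rem xT); rewrite /= => Tsize'.
  by rewrite Tsize' in Tsize; lia.
by move=> a b aB /mem_rem; apply: dead.
Qed.

Lemma dfs_kill r T B x st g :
    dfs_state r T B (x :: st) g ->
    {in T, forall y, ~~ e (c (size st).+1) x y} ->
  dfs_state r.+1 T (x :: B) st [eta g with x |-> c (size st).+1].
Proof.
case=> Sperm /= /andP[_ cst] Tsize dead xdead.
have : uniq (T ++ B ++ x :: st) by rewrite (perm_uniq Sperm) enum_uniq.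
rewrite !cat_uniq /= => /and3P[_ _ /and3P[_ /norP[xB _] _]].
split=> //=.
- by apply/permP => p; rewrite -(permP Sperm) !count_cat /= !count_cat /=; lia.
- by lia.
move=> a y; rewrite inE; have [-> _ /xdead //|_ /=] := eqVneq a x.
exact: dead.
Qed.

Definition has_cpath := exists st,
  [/\ size st = m, uniq st, {subset st <= S} & cpath st].

(** Unless it embeds the path, the search can make [#|S|] steps: before that,
    [size B < size T], so there is a vertex to push when the stack is empty. *)
Lemma dfs_run r : (r <= #|S|)%N ->
  has_cpath \/
  exists T B st g, (size st < m)%N /\ dfs_state r T B st g.
Proof.
have [m0 _|m_gt0] := posnP m; first by left; exists [::].
elim: r => [_|r IHr r_lt].
  right; exists (enum S), [::], [::], (fun=> c 0); split=> //; split=> //=.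
  - by rewrite cats0.
  - by rewrite cardE addn0.
have [|[T [B [st [g [st_lt st_r]]]]]] := IHr (ltnW r_lt); first by left.
have push x : x \in T -> cpath (x :: st) -> has_cpath \/
    exists T B st g, (size st < m)%N /\ dfs_state r.+1 T B st g.
  move=> xT cst; have st_r1 := dfs_push st_r xT cst.
  move: (st_lt); rewrite leq_eqVlt => /predU1P[m_eq|st_lt1]; last first.
    by right; exists (rem x T), B, (x :: st), g.
  left; exists (x :: st); have Sperm := dfs_perm st_r1.
  split=> // [|y y_st]; last first.
    by rewrite -mem_enum -(perm_mem Sperm) !mem_cat y_st !orbT.
  have := enum_uniq S; rewrite -(perm_uniq Sperm) catA cat_uniq.
  by case/and3P.
case: st => [|x st] in st_lt st_r push *.
  case: T => [|x T] in st_r push *; last by apply: (push x); rewrite ?mem_head.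
  by have := dfs_size st_r; move: r_lt => /=; lia.
have [/hasP[y yT exy]|/hasPn xdead] := boolP (has (e (c (size st).+1) x) T).
  by apply: (push y) => //=; rewrite exy /=; exact: dfs_path st_r.
right; exists T, (x :: B), st, [eta g with x |-> c (size st).+1].
by split; [exact: ltnW | exact: dfs_kill].
Qed.

(** After [#|S|] steps the unreached and the dead vertices are equally many, and
    the stack, which is too short to be the path, holds all the others. *)
Lemma cpath_or_nonadjacent : has_cpath \/
  exists (T B : {set V}) (g : V -> I),
    [/\ #|T| = #|B|, (#|S| < m + 2 * #|T|)%N
      & {in B & T, forall x y, ~~ e (g x) x y}].
Proof.
have [|[T [B [st [g [st_lt st_r]]]]]] := dfs_run (leqnn #|S|); first by left.
right; exists [set x in T], [set x in B], g.
case: st_r => Sperm _ Tsize dead.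
have : uniq (T ++ B ++ st) by rewrite (perm_uniq Sperm) enum_uniq.
rewrite !cat_uniq => /and3P[T_uniq _ /andP[B_uniq _]].
have cardT : #|[set x in T]| = size T by rewrite cardsE; apply/card_uniqP.
have cardB : #|[set x in B]| = size B by rewrite cardsE; apply/card_uniqP.
have sizeS : (size T + (size B + size st) = #|S|)%N.
  by rewrite cardE -(perm_size Sperm) !size_cat.
rewrite cardT cardB; split; [by lia.. | by move=> x y; rewrite !inE; exact: dead].
Qed.
End ColouredDFS.

(** * Embedding coloured paths *)

Theorem theorem10 (R : rcfType) (V : finType) (t n D : nat) (lam : R)
    (G : 'I_t -> sgraph V) (S : {set V})
    (t_gt0 : (0 < t)%N)
    (G_ndl : forall i : 'I_t, ndl_graph n D lam (G i))
    (W : finType) (P : sgraph W) (f : {set W} -> 'I_t)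
    (P_path : is_path_graph P)
    (W_le : #|W|%:R <= #|S|%:R - 2 * lam * n%:R * D%:R^-1 * Num.sqrt t%:R) :
  contains_in G S P f.
Proof.
case: P_path => s [s_uniq s_all P_edge].
have sizeW : size s = #|W|.
  by rewrite -(card_uniqP s_uniq); apply: eq_card => w; rewrite s_all.
have ix_inj : injective (index^~ s) by move=> u v; exact: (index_inj u).
(* For [0 < k < #|W|] this set consists of the vertices number [k - 1] and [k]. *)
pose c k := f [set w | (index w s == k) || (index w s == k.-1)].
have [[st [st_size st_uniq st_S st_path]]|[T [B [g [TB S_lt dead]]]]] :=
  cpath_or_nonadjacent (fun i => edge (G i)) c S #|W|.
  case: st st_size st_uniq st_S st_path =>
      [/esym/card0_eq W0 _ _ _|v0 st st_size st_uniq st_S st_path].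
    have W_empty (w : W) : False by have := W0 w.
    by exists (fun w => False_rect V (W_empty w)); split=> w; case: (W_empty w).
  set p := rev (v0 :: st).
  have ix_lt w : (index w s < size p)%N.
    by rewrite size_rev st_size -sizeW index_mem.
  have p_uniq : uniq p by rewrite rev_uniq.
  exists (fun w => nth v0 p (index w s)); split=> [u v /eqP|w|u v].
  - by rewrite nth_uniq // => /eqP/ix_inj.
  - by apply: st_S; rewrite -mem_rev mem_nth.
  have adj x y : index y s = (index x s).+1 ->
      G (f [set x; y]) (nth v0 p (index x s)) (nth v0 p (index y s)).
    move=> y_ix; have -> : [set x; y] =
        [set w | (index w s == (index x s).+1) || (index w s == index x s)].
      by apply/setP => w; rewrite !inE -y_ix !(inj_eq ix_inj) orbC.
    rewrite y_ix; apply: (cpath_nth (c := c)) st_path _.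
    by rewrite -y_ix -size_rev.
  rewrite P_edge => /orP[/eqP/adj //|/eqP/adj].
  by rewrite setUC edge_sym.
exfalso.
(* Without vertices [lam] may be negative, but then [S] is empty and so is [W]. *)
have [V0|V_gt0] := posnP #|V|.
  have X0 (X : {set V}) : #|X| = 0%N.
    by apply/eqP; rewrite -leqn0 (leq_trans (max_card _)) ?V0.
  have n0 : n = 0%N by case: (G_ndl (Ordinal t_gt0)) => <-.
  move: W_le S_lt; rewrite n0 !X0 mulr0 !mul0r subr0 ler_nat leqn0 => /eqP ->.
  by [].
have D_gt0 : (0 < D)%N by case: (G_ndl (Ordinal t_gt0)).
have lam_ge0 : 0 <= lam := ndl_lam_ge0 (G_ndl (Ordinal t_gt0)) V_gt0.
have DR_gt0 : 0 < D%:R :> R by rewrite ltr0n.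
have sumB : (#|B| = \sum_(i < t) #|[set b in B | g b == i]|)%N.
  rewrite -sum1_card (partition_big g xpredT) //=; apply: eq_bigr => i _.
  by rewrite -sum1_card; apply: eq_bigl => b; rewrite inE.
have kk_le : D%:R ^+ 2 * #|T|%:R ^+ 2 <= (lam * n%:R) ^+ 2 * t%:R.
  rewrite [#|T|%:R ^+ 2]expr2 {1}TB sumB natr_sum mulrA mulr_sumr mulr_suml.
  have -> : (lam * n%:R) ^+ 2 * t%:R = \sum_(i < t) (lam * n%:R) ^+ 2.
    by rewrite sumr_const card_ord mulr_natr.
  apply: ler_sum => i _; apply: (nonadjacent_card (G_ndl i)) => b y.
  by rewrite inE => /andP[bB /eqP <-]; apply: dead.
have k_le : #|T|%:R <= lam * n%:R * D%:R^-1 * Num.sqrt t%:R.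
  rewrite -(ler_pXn2r (isT : (0 < 2)%N)) ?nnegrE ?mulr_ge0 ?invr_ge0 ?sqrtr_ge0 ?ler0n //.
  rewrite [leRHS]exprMn sqr_sqrtr ?ler0n // exprMn exprVn mulrAC.
  by rewrite ler_pdivlMr ?exprn_gt0 // mulrC.
have : #|W|%:R + 2 * #|T|%:R <= #|S|%:R :> R by lra.
by rewrite -natrM -natrD ler_nat leqNgt S_lt.
Qed.
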